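(* Let $G$ be a finite simple graph without isolated vertices, with $m$ edges, and let $a \in \mathbb{R}$. Then $$ISD_a(G) + M_1^{a+1}(G) \ge \frac52\, m, \qquad \text{if } a>0,$$ $$ISD_a(G) + M_1^{a+1}(G) \ge 2m, \qquad \text{if } a<0.$$ The equality in the first bound (the case $a>0$) is attained if and only if $G$ is a union of path graphs $P_2$.
   Context: Graphs are undirected, finite, nonempty, simple (no loops, no multiple edges), without isolated vertices, and not necessarily connected. $d_u$ denotes the degree of the vertex $u$, and $uv$ denotes the (unordered) edge joining $u$ and $v$; sums over $uv\in E(G)$ run once over each edge. For $a\in\mathbb{R}$ the variable inverse sum deg index is $$ISD_a(G)=\sum_{uv\in E(G)}\frac{1}{d_u^a+d_v^a}.$$ For $b\in\mathbb{R}$ the variable first Zagreb index is $$M_1^{b}(G)=\sum_{u\in V(G)}d_u^{b}$$ (the superscript $b$ is a parameter, not a power). $P_2$ is the path graph with two vertices (a single edge); ''union'' means disjoint union, i.e. every connected component of $G$ is a $P_2$. *)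

(* Defs.v *)
From mathcomp Require Import all_boot all_order all_algebra.
From mathcomp Require Import reals exp.

Set Implicit Arguments.
Unset Strict Implicit.
Unset Printing Implicit Defensive.

Import Order.TTheory GRing.Theory Num.Theory.

Local Open Scope ring_scope.

Record sgraph := SGraph {
  vertex :> finType;
  adj : rel vertex;
  adj_sym : symmetric adj;
  adj_irrefl : irreflexive adj
}.

Definition deg (G : sgraph) (u : G) : nat := #|[set v : G | adj u v]|.

Definition isolated (G : sgraph) (u : G) : bool := ~~ [exists v, adj u v].

(* Edges are two-element sets of vertices, so each edge uv occurs once. *)
Definition edges (G : sgraph) : {set {set G}} :=
  [set A | [exists u, exists v, adj u v && (A == [set u; v])]].

(* For an edge A = {u, v}, the inner sum is d_u^a + d_v^a. *)
Definition ISD (R : realType) (a : R) (G : sgraph) : R :=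
  \sum_(A in edges G) (\sum_(u in A) (deg u)%:R `^ a)^-1.

(* b is the exponent of the degrees, not a power of the index. *)
Definition zagreb1 (R : realType) (b : R) (G : sgraph) : R :=
  \sum_(u : G) (deg u)%:R `^ b.

Definition path_adj (n : nat) : rel 'I_n :=
  [rel i j : 'I_n | (i.+1 == j :> nat) || (j.+1 == i :> nat)].

Lemma path_adj_sym (n : nat) : symmetric (@path_adj n).
Proof. by move=> i j; rewrite /path_adj /= orbC. Qed.

Lemma path_adj_irrefl (n : nat) : irreflexive (@path_adj n).
Proof. by move=> i; rewrite /path_adj /= orbb gtn_eqF. Qed.

Definition path_graph (n : nat) : sgraph :=
  SGraph (@path_adj_sym n) (@path_adj_irrefl n).

Definition component (G : sgraph) (u : G) : {set G} :=
  [set v | connect (@adj G) u v].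

(* The subgraph of G induced by A is isomorphic to H. *)
Definition induced_iso (G H : sgraph) (A : {set G}) : Prop :=
  exists f : H -> G,
    [/\ injective f, f @: setT = A & forall x y, adj (f x) (f y) = adj x y].

Definition union_of_P2 (G : sgraph) : Prop :=
  forall u : G, induced_iso (path_graph 2) (component u).

(* Main.v *)
Require Import Defs.
From mathcomp Require Import all_boot all_order all_algebra.
From mathcomp Require Import reals exp.
From mathcomp Require Import ring lra.

Set Implicit Arguments.
Unset Strict Implicit.
Unset Printing Implicit Defensive.

Import Order.TTheory GRing.Theory Num.Theory.

Local Open Scope ring_scope.

(** Grouping the terms of the Zagreb sum by edges (a handshake argument) gives
    [zagreb1 (a + 1) G] as the sum over the edges [uv] of
    [s = d_u^a + d_v^a] (lemma [zagreb1_edges]). The left-hand side is therefore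
    a sum over the edges of [s^-1 + s] with [s > 0], and the theorem reduces to
    a bound for this function of one variable. For all [s > 0] its minimum is
    [2]. When [a > 0] all degrees are at least [1], so that [s >= 2]; on this
    range the function is increasing and its minimum is [5 / 2], attained only
    at [s = 2] ([addVr_ge5_2]).

    Equality for [a > 0] thus means that every edge has [s = 2], that is, that
    both ends of every edge have degree [1]. Without isolated vertices this
    means that every degree is [1], which characterises the disjoint unions of
    single edges ([union_of_P2_deg1]). *)

Section Graph.
Variable G : sgraph.
Implicit Types (u v : G) (A : {set G}).

Lemma adj_neq u v : adj u v -> u != v.
Proof. by apply: contraTneq => ->; rewrite adj_irrefl. Qed.

Lemma edgesP A :
  reflect (exists u v, adj u v /\ A = [set u; v]) (A \in edges G).
Proof.
rewrite inE; apply: (iffP existsP) => [[u /existsP[v /andP[uv /eqP ->]]]|].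
  by exists u, v.
by move=> [u [v [uv ->]]]; exists u; apply/existsP; exists v; rewrite uv eqxx.
Qed.

Lemma deg_gt0 u : (0 < deg u)%N = ~~ isolated u.
Proof.
rewrite /isolated negbK; apply/card_gt0P/existsP.
  by move=> [v]; rewrite inE => uv; exists v.
by move=> [v uv]; exists v; rewrite inE.
Qed.

(** Sending a neighbour [v] of [u] to [[set u; v]] is a bijection onto the edges
    that contain [u]. *)
Lemma card_edges_at u : #|[set A in edges G | u \in A]| = deg u.
Proof.
suff -> : [set A in edges G | u \in A]
    = (fun v => [set u; v]) @: [set v | adj u v].
  apply: card_in_imset => v w; rewrite !inE => uv uw /setP/(_ v).
  by rewrite !inE eqxx orbT eq_sym (negPf (adj_neq uv)) => /esym/eqP.
apply/setP=> A; rewrite inE; apply/andP/imsetP.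
- move=> [/edgesP[x [y [xy ->]]]]; rewrite !inE => /orP[]/eqP ->.
    by exists y; rewrite ?inE.
  by exists x; rewrite ?inE ?[adj y x]adj_sym // setUC.
- move=> [v]; rewrite inE => uv ->; rewrite set21; split=> //.
  by apply/edgesP; exists u, v.
Qed.

(** Double counting of the pairs formed by an edge and one of its ends. *)
Lemma handshake (V : nmodType) (f : G -> V) :
  \sum_(A in edges G) \sum_(u in A) f u = \sum_u f u *+ deg u.
Proof.
rewrite (exchange_big_dep xpredT) //=; apply: eq_bigr => u _.
rewrite sumr_const -card_edges_at; congr (_ *+ _).
by apply: eq_card => A; rewrite [RHS]inE.
Qed.

Lemma sum_edge (V : nmodType) (f : G -> V) u v :
  adj u v -> \sum_(w in [set u; v]) f w = f u + f v.
Proof. by move=> uv; rewrite big_setU1 ?inE ?adj_neq // big_set1. Qed.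

Lemma adj_deg1 u v w : deg u = 1%N -> adj u v -> adj u w -> w = v.
Proof.
move=> /eqP/cards1P[x Nu] uv uw.
have: w \in [set t | adj u t] by rewrite inE.
have: v \in [set t | adj u t] by rewrite inE.
by rewrite Nu !inE => /eqP -> /eqP.
Qed.

Lemma component_deg1 u v :
  deg u = 1%N -> deg v = 1%N -> adj u v -> component u = [set u; v].
Proof.
move=> du dv uv; have vu : adj v u by rewrite adj_sym.
have clos x y : adj x y -> x \in [set u; v] -> y \in [set u; v].
  move=> xy; rewrite !inE => /orP[]/eqP xE; move: xy; rewrite xE => xy.
    by rewrite (adj_deg1 du uv xy) eqxx orbT.
  by rewrite (adj_deg1 dv vu xy) eqxx.
have cl : closed (@adj G) [set u; v].
  move=> x y xy; apply/idP/idP; first exact: clos xy.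
  by apply: clos; rewrite adj_sym.
apply/setP=> w; rewrite inE; apply/idP/idP => [uw|].
  by rewrite -(closed_connect cl uw) set21.
by rewrite !inE => /orP[]/eqP ->; [exact: connect0 | exact: connect1].
Qed.

Lemma union_of_P2_deg1 : (forall u, ~~ isolated u) ->
  union_of_P2 G <-> (forall u, deg u = 1%N).
Proof.
move=> noiso; split=> [GP2 u|deg1 u].
- (* A component has two vertices, one of which is [u] itself. *)
  apply/eqP; rewrite eqn_leq deg_gt0 noiso andbT.
  have [f [finj fim _]] := GP2 u.
  have <- : #|component u :\ u| = 1%N.
    have := cardsD1 u (component u).
    rewrite -{1}fim card_imset // cardsT card_ord inE connect0.
    by rewrite add1n => -[].
  apply/subset_leq_card/subsetP => v; rewrite !inE => uv.
  by rewrite eq_sym adj_neq // connect1.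
- have /negPn/existsP[v uv] := noiso u.
  rewrite (component_deg1 (deg1 u) (deg1 v) uv).
  have vu : adj v u by rewrite adj_sym.
  exists (fun i : 'I_2 => if i == ord0 then u else v); split.
  + have := adj_neq uv => /negPf nuv.
    move=> [[|[|//]] i] [[|[|//]] j] //= e; apply/val_inj => //=.
      by rewrite e eqxx in nuv.
    by rewrite e eqxx in nuv.
  + apply/setP=> w; rewrite !inE; apply/imsetP/orP.
      by move=> [i _ ->]; case: ifP; [left | right].
    by move=> [/eqP ->|/eqP ->]; [exists ord0 | exists ord_max].
  + by move=> [[|[|//]] i] [[|[|//]] j]; rewrite /path_adj //= ?adj_irrefl.
Qed.

End Graph.

Section Degrees.
Variables (R : realType) (G : sgraph).
Hypothesis noiso : forall u : G, ~~ isolated u.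
Implicit Types (a : R) (u v : G).

Lemma degR_gt0 u : 0 < (deg u)%:R :> R.
Proof. by rewrite ltr0n deg_gt0. Qed.

Lemma zagreb1_edges a :
  zagreb1 (a + 1) G = \sum_(A in edges G) \sum_(u in A) (deg u)%:R `^ a.
Proof.
rewrite handshake; apply: eq_bigr => u _.
rewrite powRD ?powRr1 ?ler0n ?mulr_natr //.
by rewrite (gt_eqF (degR_gt0 u)) implybT.
Qed.

Lemma ISD_zagreb1_edges a :
  ISD a G + zagreb1 (a + 1) G =
  \sum_(A in edges G) ((\sum_(u in A) (deg u)%:R `^ a)^-1
                       + \sum_(u in A) (deg u)%:R `^ a).
Proof. by rewrite zagreb1_edges big_split. Qed.

Lemma edge_sum_gt0 a A :
  A \in edges G -> 0 < \sum_(u in A) (deg u)%:R `^ a.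
Proof.
by move=> /edgesP[u [v [uv ->]]]; rewrite sum_edge // addr_gt0 ?powR_gt0 ?degR_gt0.
Qed.

Lemma powR_deg_ge1 a u : 0 < a -> 1 <= (deg u)%:R `^ a ?= iff (deg u == 1)%N.
Proof.
move=> a0; have d1 : (1 <= deg u)%N by rewrite deg_gt0.
move: d1; rewrite leq_eqVlt => /orP[/eqP <-|d1].
  by rewrite powR1; split; rewrite ?eqxx.
rewrite gtn_eqF //; apply/leifP.
have: 1 `^ a < (deg u)%:R `^ a.
  by rewrite gt0_ltr_powR ?nnegrE ?ler0n ?ler01 // ltr1n.
by rewrite powR1.
Qed.

Lemma edge_sum_ge2 a A : 0 < a -> A \in edges G ->
  2 <= \sum_(u in A) (deg u)%:R `^ a ?= iff [forall (u | u \in A), deg u == 1%N].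
Proof.
move=> a0 /edgesP[u [v [uv eA]]].
have -> : 2 = \sum_(u in A) 1 :> R by rewrite eA sum_edge.
by apply: leif_sum => w _; exact: powR_deg_ge1.
Qed.

End Degrees.

Section OneVariable.
Variable F : realFieldType.
Implicit Types s : F.

Lemma addVr_ge2 s : 0 < s -> 2 <= s^-1 + s.
Proof.
move=> s0; rewrite -subr_ge0.
have -> : s^-1 + s - 2 = (s - 1) ^+ 2 / s by field; rewrite gt_eqF.
by rewrite divr_ge0 ?sqr_ge0 // ltW.
Qed.

(** The two sides agree at [s = 2] and at [s = 1 / 2]; only the first root lies
    in the range, so the sign of the difference is that of [s - 2]. *)
Lemma addVr_ge5_2 s : 2 <= s -> 5 / 2 <= s^-1 + s ?= iff (2 == s).
Proof.
move=> s2; have s0 : 0 < s by lra.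
have E : s^-1 + s - 5 / 2 = (s - 2) * ((s - 1 / 2) / s).
  by field; rewrite gt_eqF.
have c0 : 0 < (s - 1 / 2) / s by rewrite divr_gt0 //; lra.
split; first by rewrite -subr_ge0 E pmulr_lge0 // subr_ge0.
by rewrite eq_sym -subr_eq0 E mulf_eq0 (gt_eqF c0) orbF subr_eq0 eq_sym.
Qed.

End OneVariable.

(** A sum of termwise lower bounds is attained only if each of them is; keeping
    the equality case inside [leif] lets it pass from the degrees to the sum over
    an edge and from there to the sum over all edges. *)
Lemma ISD_zagreb1_leif (R : realType) (G : sgraph) (a : R) :
  (forall u : G, ~~ isolated u) -> 0 < a ->
  5 / 2 * #|edges G|%:R <= ISD a G + zagreb1 (a + 1) G
    ?= iff [forall (A | A \in edges G), [forall (u | u \in A), deg u == 1%N]].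
Proof.
move=> noiso a0; rewrite ISD_zagreb1_edges // mulr_natr -sumr_const.
apply: leif_sum => A /(edge_sum_ge2 noiso a0) [s2 <-].
exact: addVr_ge5_2.
Qed.

Unset Implicit Arguments.

Theorem theorem6 (R : realType) (G : sgraph) (a : R)
    (G_nonempty : (0 < #|G|)%N)
    (G_no_isolated : forall u : G, ~~ isolated u) :
  [/\ 0 < a ->
        ISD a G + zagreb1 (a + 1) G >= 5%:R / 2%:R * #|edges G|%:R,
      a < 0 ->
        ISD a G + zagreb1 (a + 1) G >= 2%:R * #|edges G|%:R
    & 0 < a ->
        (ISD a G + zagreb1 (a + 1) G = 5%:R / 2%:R * #|edges G|%:R
         <-> union_of_P2 G)].
Proof.
split=> [a0|_|a0].
- exact: (ISD_zagreb1_leif G_no_isolated a0).1.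
- rewrite ISD_zagreb1_edges // mulr_natr -sumr_const.
  by apply: ler_sum => A AE; rewrite addVr_ge2 ?edge_sum_gt0.
- rewrite union_of_P2_deg1 //.
  have [_ eqE] := ISD_zagreb1_leif G_no_isolated a0.
  split=> [/esym/eqP|deg1].
    rewrite eqE => /forall_inP deg1 u.
    have /negPn/existsP[v uv] := G_no_isolated u.
    have /deg1/forall_inP/(_ u (set21 u v))/eqP // : [set u; v] \in edges G.
    by apply/edgesP; exists u, v.
  apply/esym/eqP; rewrite eqE.
  by apply/forall_inP => A _; apply/forall_inP => u _; rewrite deg1.
Qed.
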